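(* Let $\mathcal{A}$ and $\mathcal{B}$ be two nondeterministic Büchi automata, $K$ be a sufficiently large number, and $\varepsilon$ and $\delta$ be statistical parameters. Consider the algorithm $\mathsf{IMC}^2$ run on $(\mathcal{A},\mathcal{B},K,p_\bot,\varepsilon,\delta)$. If $\mathsf{IMC}^2$ returns $\mathit{false}$, then $\mathcal{L}(\mathcal{A}) \not\subseteq \mathcal{L}(\mathcal{B})$ is certain. Otherwise, if $\mathsf{IMC}^2$ returns $\mathit{true}$, then the probability that we would continue (sampling) and with probability $p_Z \geq \varepsilon$ find a counterexample is less than $\delta$.
   Context: A nondeterministic Büchi automaton (NBA) is $(\Sigma, Q, Q_I, T, Q_F)$ with finite alphabet $\Sigma$, finite state set $Q$, non-empty set $Q_I \subseteq Q$ of initial states, transitions $T \subseteq Q\times\Sigma\times Q$, accepting states $Q_F \subseteq Q$. It accepts an $\omega$-word if some run on it starting in $Q_I$ visits $Q_F$ infinitely often; $\mathcal{L}(\cdot)$ is the set of accepted $\omega$-words. $T(q)$ is the set of transitions with source $q$. A counterexample (to the inclusion $\mathcal{L}(\mathcal{A})\subseteq\mathcal{L}(\mathcal{B})$) is an $\omega$-word in $\mathcal{L}(\mathcal{A})\setminus\mathcal{L}(\mathcal{B})$. Let $\mathcal{A} = (\Sigma, Q, Q_I, T, Q_F)$; it is assumed that every state of $\mathcal{A}$ can reach an accepting state and has at least one outgoing transition. Let $K\ge 2$ be a natural number and $p_\bot\in(0,1)$ a stopping probability. A finite run is a sequence $q_0 a_0 q_1 \cdots a_{l-1} q_l$ with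 $q_0\in Q_I$ and $(q_j,a_j,q_{j+1})\in T$ for all $j$. A finite run $\sigma = q_0 a_0 q_1 \cdots q_n a_n q_{n+1}$ of $\mathcal{A}$ is a $K$-lasso if each state in $\{q_0,\dots,q_n\}$ occurs at most $K-1$ times in $q_0 a_0 \cdots a_{n-1} q_n$, and $q_{n+1} = q_i$ for some $0 \le i \le n$. $\sigma\bot$, with $\bot$ a fresh symbol, denotes the terminating $K$-lasso $\sigma$; $S^K_{\mathcal{A}}$ is the set of all terminating $K$-lassos. The $\omega$-word associated with $\sigma\bot$ is $uv^\omega$ with $(u,v) = (a_0\cdots a_{i-1},\, a_i\cdots a_n)$, and $\sigma\bot$ is a witness (for $\mathcal{L}(\mathcal{A})\setminus\mathcal{L}(\mathcal{B})\neq\emptyset$) if this word is accepted by $\mathcal{A}$ but not accepted by $\mathcal{B}$. Let $\#(\sigma,q)$ be the number of occurrences of state $q$ in $\sigma$. Define $\Pr'[q_0] = 1/|Q_I|$, and for $\sigma = \sigma' a_l q_{l+1}$ with $q_l$ the last state of $\sigma'$, $\Pr'[\sigma] = \Pr'[\sigma']/|T(q_l)|$ if $\#(\sigma',q_l)=1$ and $\Pr'[\sigma] = (1-p_\bot)\Pr'[\sigma']/|T(q_l)|$ if $\#(\sigma',q_l)>1$. For a terminating $K$-lasso $\sigma\bot$ with last state $q_{n+1}$, $\Pr_{p_\bot}[\sigma\bot] = \Pr'[\sigma]$ if $\#(\sigma,q_{n+1})=K$ and $\Pr_{p_\bot}[\sigma\bot] = p_\bot\cdot\Pr'[\sigma]$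 if $\#(\sigma,q_{n+1})<K$. This is a probability distribution on the finite set $S^K_{\mathcal{A}}$. Let $p_Z = \sum \Pr_{p_\bot}[\sigma\bot]$ over all witnesses $\sigma\bot\in S^K_{\mathcal{A}}$, i.e. the probability that a single sample is a witness. ''$K$ sufficiently large'' is meant in the sense that $p_Z>0$ whenever $\mathcal{L}(\mathcal{A})\setminus\mathcal{L}(\mathcal{B})\neq\emptyset$; with $n_b$ the number of states of $\mathcal{B}$, $K \geq 2 (2n_b+2)^{n_b} 2^{n_b} + 1$ is a sufficient (but not necessary) condition for this. Statistical parameters: $\varepsilon$ is the error probability (an assumed lower bound for the unknown $p_Z$) and $\delta$ is the significance level, both in $(0,1)$. The guarantee after answer $\mathit{true}$ is to be understood in the sense of statistical hypothesis testing: with $X$ the number of independent samples needed until a witness is seen, the choice $M = \lceil \ln\delta/\ln(1-\varepsilon)\rceil$ is made so that $p_Z\ge\varepsilon$ implies $\Pr[X\le M]\ge 1-\delta$. Algorithm $\mathsf{IMC}^2(\mathcal{A},\mathcal{B},K,p_\bot,\varepsilon,\delta)$: set $M = \lceil \ln\delta/\ln(1-\varepsilon)\rceil$; for each of $M$ iterations, sample a terminating $K$-lasso from $S^K_{\mathcal{A}}$ according to $\Pr_{p_\bot}$, with associated word $(u,v)$; if $uv^\omega\in\mathcal{L}(\mathcal{A})$ and $uv^\omega\notin\mathcal{L}(\mathcal{B})$, return $\mathit{false}$ together with $(u,v)$. If no iteration does so, return $\mathit{true}$.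
   Formalization: The bound ''less than δ'' is proved as ''at most δ'' in general, and strictly less than δ unless p_Z = ε and (1−ε)^M = δ; in that boundary case the probability equals δ, so the strict claim fails (e.g. p_Z = ε = δ = 1/2, M = 1). *)

(* Defs.v *)
From HB Require Import structures.
From mathcomp Require Import all_boot all_order all_algebra.
From mathcomp Require Import all_classical all_reals all_analysis.
From mathcomp Require Import ring.

Set Implicit Arguments.
Unset Strict Implicit.
Unset Printing Implicit Defensive.

Import Order.TTheory GRing.Theory Num.Theory.

Local Open Scope classical_set_scope.
Local Open Scope ring_scope.

Record nba (Sigma : finType) := NBA {
  state : finType;
  init : {set state};
  trans : {set state * Sigma * state};
  accepting : {set state};
  init_neq0 : init != finset.set0 }.

Definition lang (Sigma : finType) (A : nba Sigma) : set (nat -> Sigma) :=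
  [set w | exists rho : nat -> state A,
     [/\ rho 0%N \in init A,
         forall i, (rho i, w i, rho i.+1) \in trans A &
         forall n, exists2 m, (n <= m)%N & rho m \in accepting A]].

Definition out (Sigma : finType) (A : nba Sigma) (q : state A) :
    {set state A * Sigma * state A} :=
  [set t in trans A | t.1.1 == q]%SET.

Definition step (Sigma : finType) (A : nba Sigma) : rel (state A) :=
  fun p q => [exists a, (p, a, q) \in trans A].

Definition live (Sigma : finType) (A : nba Sigma) : Prop :=
  (forall q : state A, exists2 f, f \in accepting A & connect (@step _ A) q f) /\
  (forall q : state A, out q != finset.set0).

(* The sequence q_0 a_0 q_1 ... a_(l-1) q_l is encoded as
   (q_0, [:: (a_(l-1), q_l); ...; (a_0, q_1)]), the most recent step first, so
   that structural recursion removes the last step. *)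
Definition frun (Sigma : finType) (A : nba Sigma) : Type :=
  (state A * seq (Sigma * state A))%type.

Definition extend (Sigma : finType) (A : nba Sigma)
    (r : frun A) (a : Sigma) (q : state A) : frun A :=
  (r.1, (a, q) :: r.2).

Definition last_state (Sigma : finType) (A : nba Sigma) (r : frun A) : state A :=
  if r.2 is (_, q) :: _ then q else r.1.

Definition visited (Sigma : finType) (A : nba Sigma) (r : frun A) :
    seq (state A) :=
  r.1 :: rev (unzip2 r.2).

Definition letters (Sigma : finType) (A : nba Sigma) (r : frun A) : seq Sigma :=
  rev (unzip1 r.2).

Definition occ (Sigma : finType) (A : nba Sigma) (r : frun A) (q : state A) :
    nat :=
  count_mem q (visited r).

Fixpoint is_run_rec (Sigma : finType) (A : nba Sigma) (q0 : state A)
    (s : seq (Sigma * state A)) : bool :=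
  if s is (a, q) :: s' then
    ((@last_state _ A (q0, s'), a, q) \in trans A) && is_run_rec q0 s'
  else q0 \in init A.

Definition is_run (Sigma : finType) (A : nba Sigma) (r : frun A) : bool :=
  is_run_rec r.1 r.2.

(* A triple (s, a_n, q_(n+1)), with s = q_0 a_0 ... a_(n-1) q_n, stands for the
   run s a_n q_(n+1). *)
Definition is_lasso (Sigma : finType) (A : nba Sigma) (K : nat)
    (l : frun A * Sigma * state A) : bool :=
  let: (s, a, q) := l in
  [&& is_run (extend s a q),
      all (fun p => (occ s p <= K - 1)%N) (visited s) &
      q \in visited s].

(* S^K_A; the end marker of a terminating lasso is left implicit. *)
Definition lasso (Sigma : finType) (A : nba Sigma) (K : nat) : Type :=
  {l : frun A * Sigma * state A | is_lasso K l}.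

Definition lasso_run (Sigma : finType) (A : nba Sigma) (K : nat)
    (l : lasso A K) : frun A :=
  let: (s, a, q) := val l in extend s a q.

(* q_i = q_(n+1) and 0 <= i <= n.  When q_(n+1) occurs several times among
   q_0, ..., q_n the lasso alone does not determine i; below, [start] is an
   arbitrary rule selecting one such i for each lasso. *)
Definition loop_start (Sigma : finType) (A : nba Sigma) (K : nat)
    (l : lasso A K) (i : nat) : bool :=
  let: (s, _, q) := val l in
  (i < size (visited s))%N && (nth q (visited s) i == q).

Definition lasso_pair (Sigma : finType) (A : nba Sigma) (K : nat)
    (start : lasso A K -> nat) (l : lasso A K) : seq Sigma * seq Sigma :=
  (take (start l) (letters (lasso_run l)), drop (start l) (letters (lasso_run l))).

(* The omega-word u v^omega, for v non-empty; x0 is a dummy default letter. *)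
Definition omega_word (Sigma : finType) (x0 : Sigma) (uv : seq Sigma * seq Sigma) :
    nat -> Sigma :=
  fun n => if (n < size uv.1)%N then nth x0 uv.1 n
           else nth x0 uv.2 ((n - size uv.1) %% size uv.2).

Definition lasso_word (Sigma : finType) (A : nba Sigma) (K : nat)
    (start : lasso A K -> nat) (l : lasso A K) : nat -> Sigma :=
  let: (_, a, _) := val l in omega_word a (lasso_pair start l).

Definition witness (Sigma : finType) (A B : nba Sigma) (K : nat)
    (start : lasso A K -> nat) (l : lasso A K) : Prop :=
  lang A (lasso_word start l) /\ ~ lang B (lasso_word start l).

Fixpoint run_pr_rec (R : realType) (Sigma : finType) (A : nba Sigma) (pbot : R)
    (q0 : state A) (s : seq (Sigma * state A)) : R :=
  if s is _ :: s' then
    let r' : frun A := (q0, s') in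
    if occ r' (last_state r') == 1%N
    then run_pr_rec pbot q0 s' / #|out (last_state r')|%:R
    else (1 - pbot) * run_pr_rec pbot q0 s' / #|out (last_state r')|%:R
  else 1 / #|init A|%:R.

Definition run_pr (R : realType) (Sigma : finType) (A : nba Sigma) (pbot : R)
    (r : frun A) : R :=
  run_pr_rec pbot r.1 r.2.

Definition lasso_pr (R : realType) (Sigma : finType) (A : nba Sigma) (K : nat)
    (pbot : R) (l : lasso A K) : R :=
  let r := lasso_run l in
  if occ r (last_state r) == K then run_pr pbot r else pbot * run_pr pbot r.

Section TotalMass.
Variables (R : realType) (Sigma : finType) (A : nba Sigma) (K : nat).
Local Notation run := (frun A).
Local Notation letter := (Sigma * state A)%type.

Let ok (r : run) := is_run r && all (fun p => (occ r p <= K - 1)%N) (visited r).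

Fixpoint runs (n : nat) : seq run :=
  if n is n'.+1 then
    [seq extend r x.1 x.2 | r <- runs n', x <- enum {: Sigma * state A}]
  else [seq (q, [::]) | q <- enum (state A)].

Lemma mem_runs n (r : run) : (r \in runs n) = (size r.2 == n).
Proof.
elim: n r => [|n IHn] [q s].
  apply/mapP/eqP => [[p _ [-> ->]] //|/size0nil /= ->].
  by exists q => //; rewrite mem_enum.
apply/allpairsP/eqP => [[[[p s'] x]] [/= + _ [_ ->]]|].
  by rewrite IHn /= => /eqP->.
case: s => //= x s [sz]; exists ((q, s), x); split=> /=.
- by rewrite IHn /= sz.
- by rewrite mem_enum.
- by rewrite /extend /= -surjective_pairing.
Qed.

Lemma runs_uniq n : uniq (runs n).
Proof.
elim: n => [|n IHn] /=.
  by rewrite map_inj_uniq ?enum_uniq// => p q [].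
apply: allpairs_uniq => //; first exact: enum_uniq.
by move=> [[q s] [a p]] [[q' s'] [a' p']] _ _ [/= -> -> -> ->].
Qed.

Lemma visited_extend (r : run) a q : visited (extend r a q) = rcons (visited r) q.
Proof. by rewrite /visited /= rev_cons. Qed.

Lemma last_extend (r : run) a q : last_state (extend r a q) = q.
Proof. by []. Qed.

Lemma occ_extend (r : run) a q p :
  occ (extend r a q) p = (occ r p + (q == p))%N.
Proof. by rewrite /occ visited_extend -cats1 count_cat /= addn0. Qed.

Lemma occ_visited (r : run) p : (p \in visited r) = (0 < occ r p)%N.
Proof. by rewrite /occ -has_pred1 has_count. Qed.

Lemma ok_le (r : run) p : ok r -> (occ r p <= K - 1)%N.
Proof.
case/andP=> _ /allP h; case: (posnP (occ r p)) => [-> //|].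
by rewrite -occ_visited; apply: h.
Qed.

Lemma ok_size (r : run) : ok r -> (size r.2 < #|state A| * (K - 1))%N.
Proof.
move=> okr; have -> : (size r.2).+1 = size (visited r).
  by rewrite /= size_rev size_map.
have -> : size (visited r) = (\sum_(q : state A) occ r q)%N.
  rewrite -sum1_size; under [RHS]eq_bigr do rewrite /occ -sum1_count big_mkcond/=.
  rewrite exchange_big /=; apply: eq_bigr => q _.
  by rewrite -big_mkcond /= (big_pred1 q)// => p; rewrite /= eq_sym.
by rewrite -sum_nat_const; apply: leq_sum => q _; apply: ok_le.
Qed.

Lemma lasso_size (l : lasso A K) : (size (val l).1.1.2 < #|state A| * (K - 1))%N.
Proof.
case: l => -[[r a] q] /= /and3P[/andP[_ run_r] h _].
by apply: ok_size; rewrite /ok [is_run r]run_r.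
Qed.

Lemma is_lassoE (r : run) a q :
  is_lasso K (r, a, q) =
  [&& ok r, (last_state r, a, q) \in trans A & q \in visited r].
Proof.
rewrite /is_lasso /ok {1}/is_run /= -/(is_run r).
rewrite -surjective_pairing -/(is_run r).
by rewrite -!andbA; do 3 bool_congr; rewrite andbCA.
Qed.

Local Arguments is_lasso : simpl never.
Hypothesis K_ge2 : (2 <= K)%N.
Hypothesis liveA : live A.
Variable pbot : R.

Let raw_pr (l : run * Sigma * state A) : R :=
  let r := extend l.1.1 l.1.2 l.2 in
  if occ r l.2 == K then run_pr pbot r else pbot * run_pr pbot r.

Let cont (r : run) : R :=
  (if occ r (last_state r) == 1%N then 1 else 1 - pbot) * run_pr pbot r.

Lemma run_pr_extend (r : run) a q :
  run_pr pbot (extend r a q) = cont r / #|out (last_state r)|%:R.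
Proof.
by rewrite /cont; case: r => q0 s; rewrite /run_pr /=; case: ifP; rewrite ?mul1r.
Qed.

Lemma sum_out (q : state A) (c : R) :
  \sum_(x : letter | (q, x.1, x.2) \in trans A) c / #|out q|%:R = c.
Proof.
have [_ /(_ q)] := liveA; rewrite -card_gt0 => out_gt0.
rewrite sumr_const.
have -> : #|[pred x : letter | (q, x.1, x.2) \in trans A]| = #|out q|.
  rewrite -(card_imset _ (f := fun x : letter => (q, x.1, x.2))); last first.
    by move=> [a p] [a' p'] [/= -> ->].
  apply: eq_card => -[[q' a] p]; rewrite !inE /=.
  apply/imsetP/andP => [[[a' p'] /= tr [-> -> ->]] //|[tr /eqP eq']].
  by exists (a, p); rewrite ?inE /= -?eq'.
by rewrite -[LHS]mulr_natr divfK// pnatr_eq0 -lt0n.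
Qed.

Lemma step_mass (r : run) a q : ok r -> (last_state r, a, q) \in trans A ->
  run_pr pbot (extend r a q) =
  (if is_lasso K (r, a, q) then raw_pr (r, a, q) else 0) +
  (if ok (extend r a q) then cont (extend r a q) else 0).
Proof.
move=> okr tr; rewrite is_lassoE okr tr /= /raw_pr /cont.
have leE x : (x <= K - 1)%N = (x < K)%N.
  by rewrite -ltnS subn1 prednK// ltnW.
have ltK p : (occ r p < K)%N by rewrite -leE ok_le.
have okE : ok (extend r a q) = (occ (extend r a q) q < K)%N.
  have run_ext : is_run (extend r a q).
    rewrite /is_run /= -surjective_pairing tr /= -/(is_run r).
    by case/andP: okr.
  have [_ /allP hr] := andP okr.
  rewrite /ok run_ext andTb.
  apply/idP/idP.
    move=> /allP /(_ q).
    rewrite visited_extend mem_rcons inE eqxx /= => /(_ isT).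
    by rewrite leE.
  move=> h; apply/allP => p; rewrite visited_extend mem_rcons inE => /predU1P[->|].
    by rewrite leE.
  rewrite leE occ_extend => /hr; rewrite leE; have [<- _|_] := eqVneq q p.
    by move: h; rewrite occ_extend eqxx.
  by rewrite addn0.
rewrite okE last_extend occ_extend eqxx addn1 eqSS occ_visited.
have := ltK q; case: (ltngtP (occ r q).+1 K) => // [_|eqK] _.
  by case: (occ r q) => [|n] /=; [rewrite add0r mul1r|ring].
by case: (occ r q) eqK => [eqK|n _] /=; [by move: K_ge2; rewrite -eqK|rewrite addr0].
Qed.

Let mass n : R := \sum_(r <- runs n | ok r) cont r.
Let lmass n : R := \sum_(r <- runs n) \sum_(x : letter)
  if is_lasso K (r, x.1, x.2) then raw_pr (r, x.1, x.2) else 0.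

Lemma massS n : mass n = lmass n + mass n.+1.
Proof.
rewrite /mass /= big_mkcond [X in _ + X]big_mkcond big_allpairs_dep /= /lmass.
rewrite -big_split /=; apply: eq_bigr => r _.
rewrite [X in _ + X]big_enum /= -big_split /=.
case: ifPn => [okr|nokr].
  rewrite -[LHS](sum_out (last_state r)) big_mkcond; apply: eq_bigr => -[a q] _ /=.
  case: ifP => tr; first by rewrite -(run_pr_extend r a q) (step_mass okr tr).
  rewrite is_lassoE tr andbF add0r ifF// /ok {1}/is_run /=.
  by rewrite -surjective_pairing tr.
rewrite big1 // => -[a q] _ /=; rewrite is_lassoE (negbTE nokr) /= add0r ifF//.
apply: contraNF nokr => /andP[/andP[_ run_r] /allP h].
rewrite /ok [is_run r]run_r; apply/allP => p pr /=.
have /h : p \in visited (extend r a q) by rewrite visited_extend mem_rcons inE pr orbT.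
by rewrite occ_extend; apply: leq_trans; rewrite leq_addr.
Qed.

Lemma mass0 : mass 0 = 1.
Proof.
rewrite /mass /= big_map big_enum_cond /=.
transitivity (\sum_(q in init A) (1 / #|init A|%:R : R)).
  apply: eq_big => [q|q _].
    rewrite /ok {1}/is_run /= andbC /= /occ /= addn0 eqxx /= andbT.
    by rewrite subn_gt0 K_ge2.
  by rewrite /cont /occ /last_state /= addn0 eqxx /= mul1r.
rewrite sumr_const -[LHS]mulr_natr mul1r mulVf// pnatr_eq0 cards_eq0.
exact: init_neq0.
Qed.

Lemma mass_ge n : (#|state A| * (K - 1) <= n)%N -> mass n = 0.
Proof.
move=> le_n; rewrite /mass big_seq_cond big1 // => r /andP[].
by rewrite mem_runs => /eqP sz /ok_size; rewrite sz ltnNge le_n.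
Qed.

Let N := (#|state A| * (K - 1))%N.
Let all_raw : seq (run * Sigma * state A) :=
  [seq (r, x.1, x.2) | r <- [seq r | n <- iota 0 N, r <- runs n],
                        x <- enum {: Sigma * state A}].

Lemma all_raw_uniq : uniq all_raw.
Proof.
apply: allpairs_uniq; [|exact: enum_uniq|].
  apply: allpairs_uniq_dep; [exact: iota_uniq|by move=> n _; exact: runs_uniq|].
  have sz (u : {n : nat & run}) :
      u \in [seq existT (fun=> run) n r | n <- iota 0 N, r <- runs n] ->
      size (tagged u).2 = tag u.
    case/allpairsPdep=> m [r []] _; by rewrite mem_runs => /eqP hm ->.
  by move=> [n r] [n' r'] /sz /= <- /sz /= <- ->.
by move=> [r [a p]] [r' [a' p']] _ _ [/= -> -> ->].
Qed.

Lemma mem_all_raw (l : lasso A K) : val l \in all_raw.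
Proof.
have := lasso_size l; case: (val l) => -[r a] q /= sz.
apply/allpairsP; exists (r, (a, q)); split=> //=; last by rewrite mem_enum.
apply/allpairsPdep; exists (size r.2), r; split=> //.
  by rewrite mem_iota.
by rewrite mem_runs.
Qed.

Let lassos : seq (lasso A K) := pmap insub all_raw.

Lemma mem_lassos (l : lasso A K) : l \in lassos.
Proof. by rewrite mem_pmap_sub mem_all_raw. Qed.

Lemma lasso_finite : finite_set [set: lasso A K].
Proof.
apply: (@sub_finite_set _ _ [set` lassos]); last exact: finite_seq.
by move=> l _ /=; exact: mem_lassos.
Qed.

Lemma lasso_pr_sum1 : \sum_(l \in [set: lasso A K]) lasso_pr pbot l = 1.
Proof.
have -> : [set: lasso A K] = [set` lassos].
  by apply/seteqP; split=> // l _ /=; exact: mem_lassos.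
rewrite -fsbig_seq ?pmap_sub_uniq ?all_raw_uniq//.
transitivity (\sum_(n <- iota 0 N) lmass n).
  have -> : \sum_(l <- lassos) lasso_pr pbot l = \sum_(x <- map val lassos) raw_pr x.
    by rewrite big_map; apply: eq_bigr => -[[[r a] q] h] _.
  have -> : map val lassos = [seq x <- all_raw | is_lasso K x].
    by rewrite pmap_filter ?filter_map//; [apply: eq_filter => x; rewrite isSome_insub|exact: insubK].
  rewrite big_filter big_mkcond big_allpairs_dep big_allpairs_dep /=.
  by apply: eq_bigr => n _; apply: eq_bigr => r _; rewrite big_enum.
have H n : \sum_(i <- iota 0 n) lmass i + mass n = 1.
  elim: n => [|n <-]; first by rewrite big_nil add0r mass0.
  by rewrite -addn1 iotaD big_cat /= big_seq1 add0n addn1 (massS n) addrA.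
by rewrite -(H N) mass_ge // addr0.
Qed.
End TotalMass.

Definition p_Z (R : realType) (Sigma : finType) (A B : nba Sigma) (K : nat)
    (start : lasso A K -> nat) (pbot : R) : R :=
  \sum_(l \in [set l | witness B start l]) lasso_pr pbot l.

Definition sufficiently_large (R : realType) (Sigma : finType) (A B : nba Sigma)
    (K : nat) (start : lasso A K -> nat) (pbot : R) : Prop :=
  lang A `\` lang B !=set0 -> 0 < p_Z B start pbot.

(* Y 0, Y 1, ... are independent samples from S^K_A (discrete sigma-algebra),
   each distributed according to lasso_pr. *)
Record iid_samples (R : realType) (Sigma : finType) (A : nba Sigma) (K : nat)
    (pbot : R) (d : measure_display) (T : measurableType d)
    (P : probability T R) (Y : nat -> T -> lasso A K) : Prop := IidSamples {
  samples_measurable : forall i (E : set (lasso A K)), measurable (Y i @^-1` E);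
  samples_law : forall i (l : lasso A K),
    P (Y i @^-1` [set l]) = (lasso_pr pbot l)%:E;
  samples_independent : forall (J : seq nat) (E : nat -> set (lasso A K)),
    uniq J ->
    P (\bigcap_(j in [set` J]) (Y j @^-1` E j)) =
    (\prod_(j <- J) P (Y j @^-1` E j))%E }.

Inductive answer (Sigma : finType) : Type :=
| ReturnTrue
| ReturnFalse of seq Sigma * seq Sigma.
Arguments ReturnTrue {Sigma}.

Fixpoint imc2_loop (Sigma : finType) (A B : nba Sigma) (K : nat)
    (start : lasso A K -> nat) (M : nat) (y : nat -> lasso A K) :
    answer Sigma :=
  if M is M'.+1 then
    if `[< witness B start (y 0%N) >] then ReturnFalse (lasso_pair start (y 0%N))
    else imc2_loop B start M' (fun j => y j.+1)
  else ReturnTrue.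

Definition num_samples (R : realType) (eps delta : R) : nat :=
  `|Num.ceil (ln delta / ln (1 - eps))|%N.

Definition imc2 (R : realType) (Sigma : finType) (A B : nba Sigma) (K : nat)
    (start : lasso A K -> nat) (eps delta : R) (y : nat -> lasso A K) :
    answer Sigma :=
  imc2_loop B start (num_samples eps delta) y.

(* The random variable X: the number of samples drawn until a witness is seen,
   +oo if there is none. *)
Definition samples_until (R : realType) (Sigma : finType) (A B : nba Sigma)
    (K : nat) (start : lasso A K -> nat) (y : nat -> lasso A K) : \bar R :=
  ereal_inf [set j.+1%:R%:E | j in [set j | witness B start (y j)]].

(* Main.v *)
(* The loop answers true exactly when the first M samples all miss the
   witnesses; by independence this has probability (1 - p_Z)^M, which is at most
   (1 - eps)^M <= delta because ln (1 - eps) < 0 and M >= ln delta / ln (1 - eps).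
   The event X <= M is the complement of that one. *)
Require Import Defs.
From mathcomp Require Import all_boot all_order all_algebra.
From mathcomp Require Import all_classical all_reals all_analysis.

Set Implicit Arguments.
Unset Strict Implicit.
Unset Printing Implicit Defensive.

Import Order.TTheory GRing.Theory Num.Theory.
Local Open Scope classical_set_scope.
Local Open Scope ring_scope.

(** Both logarithms are negative. Positivity of the quotient makes the absolute value in
    [num_samples] harmless: it is taken of a positive ceiling. *)
Lemma ln_quotient_gt0 (R : realType) (eps delta : R) :
  0 < eps < 1 -> 0 < delta < 1 -> 0 < ln delta / ln (1 - eps).
Proof.
move=> /andP[eps0 eps1] delta01.
have ln_eps : ln (1 - eps) < 0 by rewrite ln_lt0// subr_gt0 eps1 ltrBlDr ltrDl.
by rewrite nmulr_lgt0 ?invr_lt0//; exact: ln_lt0.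
Qed.

(** Needed for strictness: a zeroth power is 1 whatever the base, so a strict gap between [eps] and
    [p_Z] would be lost. *)
Lemma num_samples_gt0 (R : realType) (eps delta : R) :
  0 < eps < 1 -> 0 < delta < 1 -> (0 < num_samples eps delta)%N.
Proof.
move=> eps01 delta01.
by rewrite /num_samples absz_gt0 gt_eqF// ceil_gt0 ln_quotient_gt0.
Qed.

Lemma num_samples_spec (R : realType) (eps delta : R) :
  0 < eps < 1 -> 0 < delta < 1 -> (1 - eps) ^+ num_samples eps delta <= delta.
Proof.
move=> eps01 delta01; have quot_gt0 := ln_quotient_gt0 eps01 delta01.
have /andP[eps0 eps1] := eps01; have /andP[delta0 _] := delta01.
have eps1' : 0 < 1 - eps by rewrite subr_gt0.
have ln_eps : ln (1 - eps) < 0 by rewrite ln_lt0// eps1' ltrBlDr ltrDl.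
(* After taking logarithms, division by the negative [ln (1 - eps)] reverses the inequality, which
   leaves that the quotient is at most its ceiling. *)
rewrite -ler_ln ?posrE ?exprn_gt0// lnXn// -mulr_natl -ler_ndivrMr//.
by rewrite /num_samples natr_absz ger0_norm ?ceil_ge// ltW// ceil_gt0.
Qed.

Section Imc2.
Variables (Sigma : finType) (A B : nba Sigma) (K : nat) (start : lasso A K -> nat).

Lemma imc2_loop_true (M : nat) (y : nat -> lasso A K) :
  imc2_loop B start M y = ReturnTrue <->
  forall j, (j < M)%N -> ~ witness B start (y j).
Proof.
elim: M y => [|M IHM] y /=; first by split.
case: asboolP => [w0|nw0]; first by split=> // /(_ 0%N isT).
(* The recursive call sees the shifted stream: its index [j] is index [j.+1] of [y], and index 0 is
   settled by the test. *)
rewrite IHM; split=> [nw [|j]|nw j jM]; [by []|exact: nw|exact: (nw j.+1)].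
Qed.

Lemma imc2_loop_false (M : nat) (y : nat -> lasso A K) (uv : seq Sigma * seq Sigma) :
  imc2_loop B start M y = ReturnFalse uv -> exists j, witness B start (y j).
Proof.
elim: M y => [//|M IHM] y /=.
case: asboolP => [w0 _|_ /IHM [j wj]]; first by exists 0%N.
by exists j.+1.
Qed.

Lemma samples_until_le (R : realType) (M : nat) (y : nat -> lasso A K) :
  (samples_until R B start y <= M%:R%:E)%E <->
  exists2 j, (j < M)%N & witness B start (y j).
Proof.
split=> [le_M|[j jM wj]]; last first.
  apply: (@le_trans _ _ j.+1%:R%:E); first by apply: ereal_inf_lbound; exists j.
  by rewrite lee_fin ler_nat.
apply: contrapT => no_witness.
(* Index [j] counts as [j.+1] samples, so without a witness below [M] every element of the set is at
   least [M.+1]. The empty set, with infimum [+oo], is covered too. *)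
suff : (M.+1%:R%:E <= samples_until R B start y)%E.
  by move=> /le_trans /(_ le_M); rewrite lee_fin ler_nat ltnn.
apply: le_ereal_inf_tmp => _ [j wj <-]; rewrite lee_fin ler_nat ltnS leqNgt.
by apply/negP => jM; apply: no_witness; exists j.
Qed.

Context (R : realType) (pbot : R) (d : measure_display) (T : measurableType d)
  (P : probability T R) (Y : nat -> T -> lasso A K) (Y_iid : iid_samples pbot P Y).

(** The law of a sample is given on singletons only. There are finitely many lassos, so finite
    additivity over the disjoint fibres of [Y i] extends it to all sets. *)
Lemma sample_set_pr (i : nat) (E : set (lasso A K)) :
  P (Y i @^-1` E) = (\sum_(l \in E) lasso_pr pbot l)%:E.
Proof.
have finE : finite_set E by apply: sub_finite_set (lasso_finite A K).
have -> : Y i @^-1` E = \bigcup_(l in E) (Y i @^-1` [set l]).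
  by apply/seteqP; split=> [t Et|t [l El /= ->]] //; exists (Y i t).
rewrite measure_fin_bigcup//; last 2 first.
- by move=> l m _ _ [t [/= -> ->]].
- by move=> l _; exact: samples_measurable Y_iid _ _.
rewrite -fsumEFin//; apply: eq_fsbigr => l _; exact: samples_law Y_iid _ _.
Qed.

(** Puts the event in the shape required by [samples_independent]: an intersection of preimages
    indexed by a duplicate-free list. *)
Lemma imc2_trueE (eps delta : R) :
  [set t | imc2 B start eps delta (Y ^~ t) = ReturnTrue] =
  \bigcap_(j in [set` iota 0 (num_samples eps delta)])
     (Y j @^-1` ~` [set l | witness B start l]).
Proof.
apply/seteqP; split=> [t /imc2_loop_true nw j|t nw].
  by rewrite /= mem_iota => /nw.
by apply/imc2_loop_true => j jM; apply: nw; rewrite /= mem_iota.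
Qed.

Lemma imc2_true_measurable (eps delta : R) :
  measurable [set t | imc2 B start eps delta (Y ^~ t) = ReturnTrue].
Proof.
rewrite imc2_trueE; apply: fin_bigcap_measurable => [|j _].
  exact: finite_seq.
exact: samples_measurable Y_iid _ _.
Qed.

Lemma imc2_true_pr (eps delta : R) :
  P [set t | imc2 B start eps delta (Y ^~ t) = ReturnTrue] =
  ((1 - p_Z B start pbot) ^+ num_samples eps delta)%:E.
Proof.
rewrite imc2_trueE (samples_independent Y_iid) ?iota_uniq//.
under eq_bigr => j _.
  rewrite preimage_setC probability_setC; last exact: samples_measurable Y_iid _ _.
  rewrite sample_set_pr -/(p_Z B start pbot) -EFinB; over.
by rewrite prodEFin big_const_seq count_predT size_iota -Monoid.iteropE.
Qed.

(** [p_Z] is the probability that sample 0 is a witness. The bound makes [1 - p_Z] nonnegative, as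
    monotonicity of powers requires. *)
Lemma p_Z_le1 : p_Z B start pbot <= 1.
Proof.
rewrite -lee_fin -(sample_set_pr 0); apply: probability_le1.
exact: samples_measurable Y_iid _ _.
Qed.

End Imc2.

Theorem theorem3 (R : realType) (Sigma : finType) (A B : nba Sigma)
    (liveA : live A) (K : nat) (K_ge2 : (2 <= K)%N)
    (start : lasso A K -> nat)
    (start_loop : forall l, loop_start l (start l))
    (pbot : R) (pbot01 : 0 < pbot < 1)
    (K_large : sufficiently_large B start pbot)
    (eps delta : R) (eps01 : 0 < eps < 1) (delta01 : 0 < delta < 1)
    (d : measure_display) (T : measurableType d) (P : probability T R)
    (Y : nat -> T -> lasso A K) (Y_iid : iid_samples pbot P Y) :
  (forall t uv, imc2 B start eps delta (Y ^~ t) = ReturnFalse uv ->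
     ~ (lang A `<=` lang B)) /\
  (eps <= p_Z B start pbot ->
     [/\ (P [set t | imc2 B start eps delta (Y ^~ t) = ReturnTrue]
            <= delta%:E)%E,
         (eps < p_Z B start pbot \/
            (1 - eps) ^+ num_samples eps delta != delta ->
          (P [set t | imc2 B start eps delta (Y ^~ t) = ReturnTrue]
            < delta%:E)%E) &
         ((1 - delta)%:E <=
          P [set t | (samples_until R B start (Y ^~ t)
                        <= (num_samples eps delta)%:R%:E)%E])%E]).
Proof.
split=> [t uv /imc2_loop_false [j [inA notB]] /(_ _ inA) //|eps_le].
have pZ1 : 0 <= 1 - p_Z B start pbot by rewrite subr_ge0 (p_Z_le1 B start Y_iid).
have eps0 : 0 <= 1 - eps by rewrite subr_ge0; case/andP: eps01 => _ /ltW.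
have pow_delta := num_samples_spec eps01 delta01.
have pow_le : (1 - p_Z B start pbot) ^+ num_samples eps delta
              <= (1 - eps) ^+ num_samples eps delta.
  by rewrite lerXn2r ?nnegrE// lerB.
have true_le : (P [set t | imc2 B start eps delta (Y ^~ t) = ReturnTrue]
                <= delta%:E)%E.
  by rewrite (imc2_true_pr _ _ Y_iid) lee_fin (le_trans pow_le).
split=> //.
  (* Strictness comes from either link of the chain: from the comparison of the two powers if [eps]
     is strictly below [p_Z], and otherwise from the comparison of [(1 - eps) ^+ M] with [delta],
     where M is [num_samples eps delta]. *)
  rewrite (imc2_true_pr _ _ Y_iid) lte_fin => -[eps_lt|neq].
    apply: lt_le_trans pow_delta.
    by rewrite ltrXn2r ?nnegrE// -?lt0n ?num_samples_gt0// ltrD2l ltrN2.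
  by apply: le_lt_trans pow_le _; rewrite lt_neqAle neq.
have -> : [set t | (samples_until R B start (Y ^~ t)
                    <= (num_samples eps delta)%:R%:E)%E] =
    ~` [set t | imc2 B start eps delta (Y ^~ t) = ReturnTrue].
  apply/seteqP; split=> t /=.
    by move=> /samples_until_le [j jM wj] /imc2_loop_true /(_ j jM).
  move=> not_true; apply/samples_until_le; apply: contrapT => no_witness.
  apply: not_true; apply/imc2_loop_true => j jM wj.
  by apply: no_witness; exists j.
rewrite probability_setC; last exact: (imc2_true_measurable _ _ Y_iid).
by rewrite EFinB; apply: leeB.
Qed.
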